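(* Let $F \in \mathbb{C}[x_1,\dots,x_n]$ be a homogeneous polynomial of degree $d$ and let $w_1,\dots,w_{d-1}$ be positive integers, $w_d = 1$. Then $F$ is computed by a homogeneous ABP with source in layer $0$, sink in layer $d$, and $w_k$ vertices in layer $k$ for $1 \le k \le d-1$, if and only if there exists a chain of ideals \[ I_1 \supseteq I_2 \supseteq \dots \supseteq I_{d-1} \supseteq I_d = \langle F \rangle \] in $\mathbb{C}[x_1,\dots,x_n]$ such that, for each $k$, $I_k$ is generated by $w_k$ homogeneous polynomials of degree $k$.
   Context: A homogeneous algebraic branching program (ABP) in variables $x_1,\dots,x_n$ is a layered directed graph (vertices partitioned into layers indexed by integers, every edge going from a layer to the next one) with one source and one sink, whose edges are labeled by linear forms in $x_1,\dots,x_n$. The weight of a path is the product of the labels of its edges, and the polynomial computed by the ABP is the sum of the weights of all paths from the source to the sink. *)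

(* Defs.v *)
From mathcomp Require Export all_boot all_order all_algebra.
From mathcomp Require Export boolp classical_sets reals.
From mathcomp Require Export complex mpoly.

Set Implicit Arguments.
Unset Strict Implicit.
Unset Printing Implicit Defensive.

Import Order.TTheory GRing.Theory Num.Theory.

Local Open Scope ring_scope.
Local Open Scope classical_set_scope.

(* "One source and one sink" is read graph-theoretically: exactly one vertex
   has no incoming edge and exactly one has no outgoing edge. The zero form
   is an admissible label. *)
Record abp (K : comNzRingType) (n : nat) := Abp {
  vertex : finType;
  edge : rel vertex;
  layer : vertex -> int;
  label : vertex -> vertex -> {mpoly K[n]};
  source : vertex;
  sink : vertex;
  edge_layer : forall u v, edge u v -> layer v = layer u + 1;
  label_linear : forall u v, edge u v -> label u v \is 1.-homog;
  sourceP : forall v, (forall u, ~~ edge u v) <-> v = source;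
  sinkP : forall v, (forall u, ~~ edge v u) <-> v = sink
}.

Section AbpPoly.
Variables (K : comNzRingType) (n : nat) (A : abp K n).

Fixpoint path_weight (v : vertex A) (p : seq (vertex A)) : {mpoly K[n]} :=
  if p is u :: p' then label v u * path_weight u p' else 1.

(* The bound #|vertex A| on the number of edges of a path loses nothing: see
   abp_path_size below. *)
Definition abp_poly : {mpoly K[n]} :=
  \sum_(m < #|vertex A|)
    \sum_(p : m.-tuple (vertex A) |
            path (@edge _ _ A) (source A) p && (last (source A) p == sink A))
      path_weight (source A) p.

Lemma abp_path_size (v : vertex A) (p : seq (vertex A)) :
  path (@edge _ _ A) v p -> (size p < #|vertex A|)%N.
Proof.
move=> vp; have ltP : path (relpre (@layer _ _ A) <%R) v p.
  by apply: sub_path vp => x y /edge_layer /= ->; rewrite ltrDl.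
have Up : uniq (v :: p).
  apply: (@sorted_uniq _ (relpre (@layer _ _ A) <%R)) => //.
  - by move=> y x z /=; apply: lt_trans.
  - by move=> x /=; rewrite ltxx.
by rewrite -[(size p).+1]/(size (v :: p)) -(card_uniqP Up) max_card.
Qed.

End AbpPoly.

(* The library's idealr_closed only covers proper ideals given by boolean
   predicates. *)
Definition is_ideal (S : comNzRingType) (I : set S) : Prop :=
  [/\ I 0, forall x y, I x -> I y -> I (x + y) & forall a x, I x -> I (a * x)].

Definition ideal_gen (S : comNzRingType) (G : set S) : set S :=
  smallest (@is_ideal S) G.

(* Main.v *)
(** For a vertex [v] in layer [k] let [P v] be the sum of the weights of the
    paths from the source to [v]; it is a form of degree [k], and splitting off
    the last edge gives [P v = \sum_u P u * label u v].  So the ideals generated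
    by the [P v], [v] in layer [k], form the required chain.  Conversely, each
    generator of [I_(k+1)] is a combination of the generators of [I_k] whose
    coefficients may be replaced by their components of degree 1; these
    components label the edges of an ABP that is complete between consecutive
    layers and in which [P v] is the generator attached to [v]. *)

Require Import Defs.
From mathcomp Require Import zify.

Import Order.TTheory GRing.Theory Num.Theory.

Local Open Scope ring_scope.
Local Open Scope classical_set_scope.

(** * Homogeneous components and ideals generated by finite families *)

Lemma pihomogMr (K : comNzRingType) (n e k : nat) (a g : {mpoly K[n]}) :
  g \is k.-homog -> pihomog mdeg (e + k) (a * g) = pihomog mdeg e a * g.
Proof.
(* [N] is at least [msize a], so the components of degree below [N] add up to [a]; it also exceeds
   [e], so the component of degree [e] is among them even when it vanishes. *)
move=> g_homog; set N := maxn (msize a) e.+1.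
have aE : a = \sum_(i < N) pihomog mdeg i a.
  by apply: pihomog_partitionE; rewrite leq_maxl.
have ltN : (e < N)%N by rewrite leq_maxr.
rewrite {1}aE mulr_suml raddf_sum (bigD1 (Ordinal ltN)) //= big1 ?addr0.
  by rewrite pihomog_dE // dhomogM // pihomogP.
move=> i ine; apply: (@pihomog_ne0 _ _ _ (i + k)%N).
  by rewrite eqn_add2r; apply: contraNneq ine => ie; apply/eqP/val_inj.
by rewrite dhomogM // pihomogP.
Qed.

Lemma ideal_gen_ideal (S : comNzRingType) (G : set S) : is_ideal (ideal_gen G).
Proof.
split=> [J [[J0 _ _] _]|x y Gx Gy J JP|a x Gx J JP]; first exact: J0.
  by have [[_ JD _] _] := JP; apply: JD; [apply: Gx | apply: Gy].
by have [[_ _ JM] _] := JP; apply: JM; apply: Gx.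
Qed.

Lemma ideal_sum (S : comNzRingType) (J : set S) (T : finType) (P : pred T)
    (f : T -> S) :
  is_ideal J -> (forall i, P i -> J (f i)) -> J (\sum_(i | P i) f i).
Proof. by case=> J0 JD _ Jf; elim/big_ind: _. Qed.

(** The combinations of the [g i] already form an ideal containing every [g i], so they contain the
    smallest one. *)
Lemma ideal_gen_comb (S : comNzRingType) (T : finType) (g : T -> S) (x : S) :
  ideal_gen (range g) x -> exists a : T -> S, x = \sum_i a i * g i.
Proof.
pose J : set S := [set y | exists a : T -> S, y = \sum_i a i * g i].
apply: (@smallest_sub _ _ _ J) => [|_ [i _ <-]]; first split.
- by exists (fun=> 0); rewrite big1 // => i _; rewrite mul0r.
- move=> _ _ [a ->] [b ->]; exists (fun i => a i + b i).
  by rewrite -big_split; apply: eq_bigr => i _; rewrite mulrDl.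
- move=> c _ [a ->]; exists (fun i => c * a i).
  by rewrite mulr_sumr; apply: eq_bigr => i _; rewrite mulrA.
exists (fun j => (j == i)%:R); rewrite (bigD1 i) //= eqxx mul1r big1 ?addr0 //.
by move=> j /negPf ->; rewrite mul0r.
Qed.

(** Taking components of degree [e + k] in any representation of [x] by the [g i] replaces each
    coefficient by its component of degree [e]. *)
Lemma homog_ideal_gen_comb (K : comNzRingType) (n e k : nat) (T : finType)
    (g : T -> {mpoly K[n]}) (x : {mpoly K[n]}) :
  (forall i, g i \is k.-homog) -> x \is (e + k).-homog ->
  ideal_gen (range g) x ->
  exists2 a : T -> {mpoly K[n]},
    forall i, a i \is e.-homog & x = \sum_i a i * g i.
Proof.
move=> g_homog x_homog /ideal_gen_comb[a xE].
exists (fun i => pihomog mdeg e (a i)) => [i|]; first exact: pihomogP.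
rewrite -(pihomog_dE x_homog) xE raddf_sum /=.
by apply: eq_bigr => i _; rewrite pihomogMr.
Qed.

(** * Sums over the paths of a fixed length *)

Section PathSum.
Variables (K : comNzRingType) (n : nat) (A : abp K n).
Implicit Types (u v : vertex A) (m : nat).

(** This is the entry at [(u, v)] of the [m]-th power of the matrix of labels, with 0 for
    non-edges. *)
Fixpoint path_sum m u v : {mpoly K[n]} :=
  if m is m'.+1 then \sum_(t | edge t v) path_sum m' u t * label t v
  else (u == v)%:R.

(** Needed because [path_weight] peels off the first edge of a path, whereas [path_sum] peels off
    the last. *)
Lemma path_sum_head m u v :
  path_sum m.+1 u v = \sum_(t | edge u t) label u t * path_sum m t v.
Proof.
elim: m v => [|m IHm] v.
  (* For [m = 0] the Kronecker deltas leave the same thing on both sides: the label from [u] to [v]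
     if there is an edge, and 0 otherwise. *)
  rewrite /= big_mkcond [RHS]big_mkcond (bigD1 u) //= eqxx mul1r big1 ?addr0.
    rewrite [RHS](bigD1 v) //= eqxx mulr1 [X in _ + X]big1 ?addr0 // => t.
    by move/negPf->; rewrite mulr0 if_same.
  by move=> t; rewrite eq_sym => /negPf->; rewrite mul0r if_same.
rewrite [LHS]/=.
under eq_bigr => t _ do rewrite -/(path_sum m.+1 u t) IHm mulr_suml.
rewrite exchange_big /=; apply: eq_bigr => t _.
by rewrite mulr_sumr; apply: eq_bigr => s _; rewrite mulrA.
Qed.

Lemma path_sumE m u v :
  path_sum m u v =
  \sum_(p : m.-tuple (vertex A) | path (@edge _ _ A) u p && (last u p == v))
     path_weight u p.
Proof.
elim: m u => [|m IHm] u.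
  rewrite (eq_bigl (fun p => (p == [tuple]) && (u == v))); last first.
    by move=> p; rewrite tuple0 eqxx.
  rewrite big_mkcondr big_pred1_eq /=.
  by case: (u == v).
rewrite path_sum_head.
(* [h] and [h'] are inverse bijections that split a nonempty path into its first vertex and the
   rest. *)
pose h (q : vertex A * m.-tuple (vertex A)) := [tuple of q.1 :: q.2].
pose h' (p : m.+1.-tuple (vertex A)) := (thead p, [tuple of behead p]).
rewrite (reindex h) /=; last first.
  exists h' => [[t q]|p] _; first by congr pair; apply: val_inj.
  by rewrite [p]tuple_eta; apply: val_inj.
rewrite (eq_bigl (fun q : vertex A * m.-tuple (vertex A) => edge u q.1 &&
    (path (@edge _ _ A) q.1 q.2 && (last q.1 q.2 == v)))); last first.
  by move=> q; rewrite andbA.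
rewrite -(pair_big_dep (fun t => edge u t)
  (fun t (q : m.-tuple (vertex A)) =>
     path (@edge _ _ A) t q && (last t q == v))
  (fun t (q : m.-tuple (vertex A)) => label u t * path_weight t q)) /=.
by apply: eq_bigr => t _; rewrite IHm mulr_sumr.
Qed.

(** Every edge climbs exactly one layer, so a path with [m] edges ends [m] layers above its
    start. *)
Lemma path_sum_layer m u v :
  layer v != layer u + m%:Z -> path_sum m u v = 0.
Proof.
elim: m v => [|m IHm] v /=.
  by rewrite addr0; have [->|] := eqVneq u v; rewrite ?eqxx.
move=> v_m; rewrite big1 // => t /edge_layer vt.
rewrite IHm ?mul0r //; apply: contraNneq v_m => tu.
by rewrite vt tu -addrA -PoszD addn1.
Qed.

Lemma path_sum_homog m u v : path_sum m u v \is m.-homog.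
Proof.
elim: m v => [|m IHm] v /=; first by case: eqP; rewrite ?dhomog1 ?dhomog0.
by apply: rpred_sum => t tv; rewrite -addn1 dhomogM ?label_linear.
Qed.

Lemma abp_polyE m :
  layer (sink A) = layer (source A) + m%:Z ->
  abp_poly A = path_sum m (source A) (sink A).
Proof.
move=> sinkE; rewrite /abp_poly.
under eq_bigr => i _ do rewrite -path_sumE.
have nz i : i != m -> path_sum i (source A) (sink A) = 0.
  move=> im; apply: path_sum_layer; rewrite sinkE.
  by rewrite (inj_eq (addrI _)) eqz_nat eq_sym.
case: (ltnP m #|vertex A|) => [lt_m|le_m].
  rewrite (bigD1 (Ordinal lt_m)) //= big1 ?addr0 // => i im.
  by rewrite nz //; apply: contraNneq im => im; apply/eqP/val_inj.
(* Here the length [m] is outside the range of the sum in [abp_poly]. Both sides are 0, since no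
   path has as many as [#|vertex A|] edges. *)
rewrite big1 => [|i _].
  rewrite path_sumE big_pred0 // => p; apply/negP => /andP[/abp_path_size].
  by rewrite size_tuple ltnNge le_m.
by rewrite nz //; apply: contraTneq (ltn_ord i) => ->; rewrite -leqNgt.
Qed.

End PathSum.

(** * The ABP that is complete between consecutive layers *)

Section LayeredAbp.
Variables (K : comNzRingType) (n d : nat) (W : nat -> nat).
(** [c k i j] will label the edge from vertex [j] of layer [k] to vertex [i] of layer [k.+1]. Plain
    natural indices keep the labels free of types depending on [k]. *)
Variable c : nat -> nat -> nat -> {mpoly K[n]}.
Hypothesis W0 : W 0 = 1%N.
Hypothesis Wd : W d = 1%N.
Hypothesis W_gt0 : forall k, (k <= d)%N -> (0 < W k)%N.
Hypothesis c_linear : forall k i j, c k i j \is 1.-homog.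

Let V : finType := {k : 'I_d.+1 & 'I_(W k)}.
Let lay (v : V) : nat := tag v.
Let pos (v : V) : nat := tagged v.

Let mkV k i (kd : (k < d.+1)%N) (iW : (i < W k)%N) : V :=
  Tagged (fun l : 'I_d.+1 => 'I_(W l)) (Ordinal iW : 'I_(W (Ordinal kd))).

Let V_inj (u v : V) : lay u = lay v -> pos u = pos v -> u = v.
Proof.
case: u v => [k i] [l j]; rewrite /lay /pos /= => /val_inj kl.
by case: l / kl j => j /val_inj ->.
Qed.

Let E : rel V := fun u v => lay v == (lay u).+1.
Let src : V := @mkV _ _ (ltn0Sn d) (W_gt0 _ (leq0n d)).
Let snk : V := @mkV _ _ (ltnSn d) (W_gt0 _ (leqnn d)).

Let pos_lt (v : V) : (pos v < W (lay v))%N.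
Proof. exact: ltn_ord. Qed.

Let lay_le (v : V) : (lay v <= d)%N.
Proof. by rewrite -ltnS ltn_ord. Qed.

Let big_layer (S : Type) (x : S) (op : Monoid.com_law x) k (f : nat -> S) :
  (k <= d)%N ->
  \big[op/x]_(v : V | lay v == k) f (pos v) = \big[op/x]_(i < W k) f i.
Proof.
move=> kd; pose k' := Ordinal (kd : (k < d.+1)%N).
have := sig_big_dep (op := op) (fun l : 'I_d.+1 => l == k')
  (fun l (i : 'I_(W l)) => true) (fun l (i : 'I_(W l)) => f i).
rewrite big_pred1_eq /= => ->.
by apply: eq_bigl => v; rewrite andbT.
Qed.

Let E_layer u v : E u v -> (lay v)%:Z = (lay u)%:Z + 1.
Proof. by move=> /eqP ->; rewrite -PoszD addn1. Qed.

(** A vertex in a positive layer has an incoming edge because the layer below is nonempty, and layer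
    0 has a single vertex by [W0]. The sink is treated symmetrically with [Wd]. *)
Let src_uniq v : (forall u, ~~ E u v) <-> v = src.
Proof.
split=> [v_in|-> u]; last by [].
have := v_in; have := pos_lt v; have := lay_le v.
case lE : (lay v) => [|k] kd iW noE.
  apply: V_inj => //; move: iW; rewrite W0 ltnS leqn0 => /eqP->.
  by [].
have kd' : (k < d.+1)%N by apply: leqW.
by have := noE (@mkV _ _ kd' (W_gt0 _ (ltnW kd))); rewrite /E lE /= eqxx.
Qed.

Let snk_uniq v : (forall u, ~~ E v u) <-> v = snk.
Proof.
split=> [v_out|-> u]; last first.
  by apply/negP => /eqP uE; have := lay_le u; rewrite uE ltnn.
have := lay_le v; rewrite leq_eqVlt => /orP[/eqP lE|lt_d].
  by apply: V_inj => //; have := pos_lt v; rewrite lE Wd ltnS leqn0 => /eqP->.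
by have := v_out (@mkV (lay v).+1 _ lt_d (W_gt0 _ lt_d)); rewrite /E /= eqxx.
Qed.

Definition layered_abp : abp K n :=
  @Abp K n V E (fun v => (lay v)%:Z)
    (fun u v => c (lay u) (pos v) (pos u)) src snk
    E_layer (fun u v _ => c_linear _ _ _) src_uniq snk_uniq.

Lemma layered_abp_card k : (k <= d)%N ->
  #|[pred v : vertex layered_abp | layer v == k%:Z]| = W k.
Proof.
move=> kd; rewrite -sum1_card; have := big_layer _ _ addn _ (fun=> 1%N) kd.
by rewrite [RHS]sum1_card card_ord => <-; apply: eq_bigl.
Qed.

Lemma layered_abp_poly (G : nat -> nat -> {mpoly K[n]}) :
  G 0 0 = 1 ->
  (forall k i, (k < d)%N -> (i < W k.+1)%N ->
     G k.+1 i = \sum_(j < W k) c k i j * G k j) ->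
  abp_poly layered_abp = G d 0.
Proof.
move=> G0 GS; rewrite (@abp_polyE _ _ layered_abp d) //=.
(* The claim is extended from the sink to all vertices, so that induction on the layer can match the
   recursion of [G] with that of [path_sum]. *)
suff H k (v : V) : lay v = k -> path_sum _ _ layered_abp k src v = G k (pos v).
  by rewrite H.
elim: k v => [|k IHk] v lE.
  have /src_uniq -> : forall u, ~~ E u v by move=> u; rewrite /E lE.
  by rewrite /= eqxx G0.
have kd : (k < d)%N by rewrite -lE lay_le.
rewrite GS //; last by rewrite -lE pos_lt.
rewrite -(big_layer _ _ +%R _ (fun j => c k (pos v) j * G k j) (ltnW kd)) /=.
apply: eq_big => [u|u]; rewrite /edge /= /E lE eqSS eq_sym // => /eqP uE.
by rewrite IHk // uE mulrC.
Qed.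

End LayeredAbp.

(** * From an ABP to a chain of ideals *)

Lemma chain_of_abp (K : comNzRingType) (n d : nat) (w : nat -> nat)
    (A : abp K n) :
  (0 < d)%N -> w d = 1%N -> layer (source A) = 0 -> layer (sink A) = d%:Z ->
  (forall k : nat, (1 <= k <= d - 1)%N ->
     #|[pred v : vertex A | layer v == k%:Z]| = w k) ->
  exists I : nat -> set {mpoly K[n]},
     [/\ forall k : nat, (1 <= k <= d)%N -> is_ideal (I k),
         forall k : nat, (1 <= k <= d - 1)%N -> I k.+1 `<=` I k,
         I d = ideal_gen [set abp_poly A]
       & forall k : nat, (1 <= k <= d)%N ->
           exists g : 'I_(w k) -> {mpoly K[n]},
             (forall i, g i \is k.-homog) /\ I k = ideal_gen (range g)].
Proof.
move=> d_gt0 w_d src0 snkd cardE.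
pose P k v := path_sum _ _ A k (source A) v.
have FE : abp_poly A = P d (sink A) by apply: abp_polyE; rewrite src0 add0r.
pose G k := [set P k v | v in [set v : vertex A | layer v = k%:Z]].
(* The recursion for [P k.+1 v] runs over all predecessors [u]; those outside layer [k] contribute
   nothing, as [P k u] is then 0. *)
have PI k v : ideal_gen (G k) (P k.+1 v).
  have GI := ideal_gen_ideal _ (G k).
  apply: ideal_sum => // u _; rewrite mulrC.
  case: GI => G0 _ GM; apply: GM; change (ideal_gen (G k) (P k u)).
  have [uk|uk] := eqVneq (layer u) k%:Z.
    by apply: sub_gen_smallest; exists u.
  suff -> : P k u = 0 by [].
  by apply: path_sum_layer; rewrite src0 add0r.
(* [cardE] counts the vertices only up to layer [d - 1], so at [k = d] the generator is taken to be
   the computed polynomial itself. *)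
exists (fun k => ideal_gen (if (k < d)%N then G k else [set abp_poly A])).
split.
- by move=> k _; apply: ideal_gen_ideal.
- move=> k /andP[k_gt0 kd]; have lt_kd : (k < d)%N by lia.
  rewrite lt_kd; apply: smallest_sub; first exact: ideal_gen_ideal.
  case: ifP => [_ _ [v _ <-]|kd' _ ->]; first exact: PI.
  have dE : d = k.+1 by lia.
  by rewrite FE {1}dE; apply: PI.
- by rewrite ltnn.
move=> k /andP[k_gt0 le_kd]; case: ltnP => [lt_kd|le_dk]; last first.
  have -> : k = d by apply/eqP; rewrite eqn_leq le_kd.
  exists (fun=> abp_poly A); split=> [_|]; first by rewrite FE path_sum_homog.
  congr ideal_gen; apply/seteqP; split=> [_ ->|_ [_ _ <-]] //.
  by rewrite w_d; exists ord0.
have kd : (1 <= k <= d - 1)%N by lia.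
exists (fun i => P k (enum_val (cast_ord (esym (cardE k kd)) i))).
split=> [i|]; first exact: path_sum_homog.
congr ideal_gen; apply/seteqP; split=> [_ [v vk <-]|_ [i _ <-]].
  have vL : v \in [pred v : vertex A | layer v == k%:Z] by rewrite inE vk.
  exists (cast_ord (cardE k kd) (enum_rank_in vL v)) => //.
  by rewrite cast_ordK enum_rankK_in.
exists (enum_val (cast_ord (esym (cardE k kd)) i)) => //.
by have := enum_valP (cast_ord (esym (cardE k kd)) i); rewrite inE => /eqP.
Qed.

(** * From a chain of ideals to an ABP *)

Lemma abp_of_chain (K : comNzRingType) (n d : nat) (F : {mpoly K[n]})
    (w : nat -> nat) (I : nat -> set {mpoly K[n]}) :
  (0 < d)%N -> F \is d.-homog ->
  (forall k : nat, (1 <= k <= d - 1)%N -> (0 < w k)%N) -> w d = 1%N ->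
  (forall k : nat, (1 <= k <= d - 1)%N -> I k.+1 `<=` I k) ->
  I d = ideal_gen [set F] ->
  (forall k : nat, (1 <= k <= d)%N ->
     exists g : 'I_(w k) -> {mpoly K[n]},
       (forall i, g i \is k.-homog) /\ I k = ideal_gen (range g)) ->
  exists A : abp K n,
     [/\ layer (source A) = 0,
         layer (sink A) = d%:Z,
         forall k : nat, (1 <= k <= d - 1)%N ->
           #|[pred v : vertex A | layer v == k%:Z]| = w k
       & abp_poly A = F].
Proof.
move=> d_gt0 F_homog w_gt0 w_d I_chain IdE I_gen.
have /choice[g gP] k : exists g : nat -> {mpoly K[n]}, (1 <= k <= d)%N ->
    (forall i : 'I_(w k), g i \is k.-homog) /\
    I k = ideal_gen (range (fun i : 'I_(w k) => g i)).
  have [kd|_] := boolP (1 <= k <= d)%N; last by exists (fun=> 0).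
  have [g [g_homog IE]] := I_gen k kd.
  exists (fun i => oapp g 0 (insub i)) => _.
  have gE (i : 'I_(w k)) : oapp g 0 (insub (i : nat)) = g i by rewrite valK.
  split=> [i|]; first by rewrite gE.
  by rewrite IE; under [in RHS]eq_fun => i do rewrite gE.
(* Layer 0 gets one vertex carrying 1. In degree [d] the chosen generator is replaced by [F]: it
   generates the same ideal but may differ from [F], and the ABP has to compute [F] itself. *)
pose W k := if k == 0%N then 1%N else w k.
pose G k i := if k == 0%N then 1 else if k == d then F else g k i.
have G_homog k i : (k < d)%N -> (i < W k.+1)%N -> G k.+1 i \is k.+1.-homog.
  rewrite /G /W /= => kd iW; have [->|_] := eqVneq k.+1 d; first by [].
  by have [+ _] := gP k.+1 kd; move/(_ (Ordinal iW)).
have GI k i : (k < d)%N -> (i < W k.+1)%N -> I k.+1 (G k.+1 i).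
  rewrite /G /W /= => kd iW; have [->|_] := eqVneq k.+1 d.
    by rewrite IdE; apply: sub_gen_smallest.
  have [_ ->] := gP k.+1 kd; apply: sub_gen_smallest.
  by exists (Ordinal iW).
have /choice[c cP] (ki : nat * nat) : exists c : nat -> {mpoly K[n]},
    (forall j, c j \is 1.-homog) /\
    ((ki.1 < d)%N -> (ki.2 < W ki.1.+1)%N ->
     G ki.1.+1 ki.2 = \sum_(j < W ki.1) c j * G ki.1 j).
  case: ki => k i /=.
  have [/andP[kd iW]|kiN] := boolP ((k < d)%N && (i < W k.+1)%N); last first.
    (* Labels must be linear at all indices, including meaningless ones; 0 is homogeneous of every
       degree. *)
    exists (fun=> 0); split=> [j|kd iW]; first exact: dhomog0.
    by rewrite kd iW in kiN.
  have [k0|k_gt0] := posnP k.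
    (* Out of the source, the label is the target form itself, which has degree 1. *)
    exists (fun=> G k.+1 i); split=> [j|_ _].
      by move: (G_homog k i kd iW); rewrite k0.
    by rewrite k0 /W big_ord1 mulr1.
  have kd1 : (1 <= k <= d - 1)%N by lia.
  have [|g_homog IE] := gP k; first by lia.
  have Gk j : G k j = g k j by rewrite /G (gtn_eqF k_gt0) (ltn_eqF kd).
  (* The inclusion of [I k.+1] in [I k] turns the form of degree [k.+1] into a combination of the
     [g k j] with linear coefficients: these are the labels. *)
  have := I_chain k kd1 _ (GI k i kd iW); rewrite IE.
  case/(homog_ideal_gen_comb _ _ 1 _ _ _ _ g_homog (G_homog k i kd iW)).
  move=> a a_homog GE.
  exists (fun j => oapp a 0 (insub j)); split=> [j|_ _].
    by case: insub => [j'|]; rewrite ?dhomog0 //=.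
  rewrite GE /W (gtn_eqF k_gt0); apply: eq_bigr => j _.
  by rewrite valK Gk.
have W0 : W 0 = 1%N by [].
have Wd : W d = 1%N by rewrite /W (gtn_eqF d_gt0).
have W_gt0 k : (k <= d)%N -> (0 < W k)%N.
  rewrite /W; case: eqP => // k0 kd.
  have [->|kd'] := eqVneq k d; first by rewrite w_d.
  by apply: w_gt0; lia.
exists (layered_abp _ _ _ _ _ W0 Wd W_gt0 (fun k i => (cP (k, i)).1)).
split=> //.
  move=> k kd; rewrite layered_abp_card; last by lia.
  by rewrite /W; case: k kd.
rewrite (layered_abp_poly _ _ _ _ _ _ _ _ _ G) //.
  by rewrite /G (gtn_eqF d_gt0) eqxx.
by move=> k i; apply: (cP (k, i)).2.
Qed.

Theorem theorem23 (R : realType) (n d : nat) (F : {mpoly R[i][n]})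
  (w : nat -> nat) (d_gt0 : (0 < d)%N) (F_homog : F \is d.-homog)
  (w_gt0 : forall k : nat, (1 <= k <= d - 1)%N -> (0 < w k)%N)
  (w_d : w d = 1%N) :
  (exists A : abp R[i] n,
     [/\ layer (source A) = 0,
         layer (sink A) = d%:Z,
         forall k : nat, (1 <= k <= d - 1)%N ->
           #|[pred v : vertex A | layer v == k%:Z]| = w k
       & abp_poly A = F])
  <->
  (exists I : nat -> set {mpoly R[i][n]},
     [/\ forall k : nat, (1 <= k <= d)%N -> is_ideal (I k),
         forall k : nat, (1 <= k <= d - 1)%N -> I k.+1 `<=` I k,
         I d = ideal_gen [set F]
       & forall k : nat, (1 <= k <= d)%N ->
           exists g : 'I_(w k) -> {mpoly R[i][n]},
             (forall i, g i \is k.-homog) /\ I k = ideal_gen (range g)]).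
Proof.
split=> [[A [src0 snkd cardE <-]]|[I [_ I_chain IdE I_gen]]].
  exact: chain_of_abp.
exact: abp_of_chain I_gen.
Qed.
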